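(* Let $n\ge 8$ and let $P_{\mathcal C}(n)=\mathrm{conv}\{(x,y)\in\mathbb R^2:\ \exists G \text{ a connected graph of order } n \text{ with } \alpha(G)=x,\ F(G)=y\}$. Then the polytope $P_{\mathcal C}(n)$ has exactly $n-1$ facets, defined by the inequalities \[ y\ge (2^k-1)x+2^k(1-k)+n,\quad k=1,2,\dots,n-2, \] and \[ y\le \frac{2^{n-1}-n}{n-2}(x-1)+n+1. \]
   Context: Graphs are finite, simple, undirected. $\alpha(G)$ is the stability number of $G$ and $F(G)$ (the Fibonacci index) is the number of stable sets of $G$ including the empty set. conv denotes convex hull. *)

(* Defs.v *)
From mathcomp Require Import all_boot all_order all_algebra.
From mathcomp Require Import classical_sets cardinality reals convex.
Set Implicit Arguments.
Unset Strict Implicit.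
Unset Printing Implicit Defensive.
Import Order.TTheory GRing.Theory Num.Theory.
Local Open Scope classical_set_scope.
Local Open Scope ring_scope.

Record sgraph := SGraph {
  vertex :> finType;
  edge : rel vertex;
  edge_sym : symmetric edge;
  edge_irr : irreflexive edge }.

Definition connected_graph (G : sgraph) : Prop :=
  forall x y : G, connect (@edge G) x y.

Definition stable (G : sgraph) (S : {set G}) : bool :=
  [forall x in S, forall y in S, ~~ edge x y].

Definition stability_number (G : sgraph) : nat :=
  (\max_(S : {set G} | stable S) #|S|)%N.

Definition fibonacci_index (G : sgraph) : nat :=
  #|[set S : {set G} | stable S]|.

Section Polytopes.
Variables (R : realType) (V : lmodType R).

Definition conv_hull (A : set V) : set V := smallest (@convex_set R V) A.

Definition affinely_independent (k : nat) (p : 'I_k -> V) : Prop :=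
  forall l : 'I_k -> R,
    \sum_i l i = 0 -> \sum_i l i *: p i = 0 -> forall i, l i = 0.

(* [affine_rank A k] means that the affine dimension of [A] is [k - 1];
   the shift by one gives the empty set dimension -1. *)
Definition affine_rank (A : set V) (k : nat) : Prop :=
  (exists p : 'I_k -> V, (forall i, A (p i)) /\ affinely_independent p) /\
  (forall (m : nat) (p : 'I_m -> V),
     (forall i, A (p i)) -> affinely_independent p -> (m <= k)%N).

(* The improper faces [P] ([c] = 0, [d] = 0) and [set0] are included. *)
Definition face (P F : set V) : Prop :=
  exists (c : {linear V -> R^o}) (d : R),
    (forall p, P p -> c p <= d) /\ F = P `&` [set p | c p = d].

Definition facets (P : set V) : set (set V) :=
  [set F | face P F /\ exists k, affine_rank P k.+1 /\ affine_rank F k].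

End Polytopes.

(* [R^o * R^o] is the plane as an [lmodType R]; points are pairs (x, y). *)
Definition connected_polytope (R : realType) (n : nat) : set (R^o * R^o)%type :=
  conv_hull [set p : (R^o * R^o)%type | exists G : sgraph,
    [/\ connected_graph G, #|G| = n,
        (stability_number G)%:R = p.1 & (fibonacci_index G)%:R = p.2]].
Arguments connected_polytope : clear implicits.

(* Main.v *)
(* Lower facets: the subsets of a maximum stable set together with the singletons
   outside it give [F(G) >= 2^a + n - a] with [a = alpha(G)], with equality for
   complete split graphs, and [2^x - x + n] is convex.

   Upper facet: the line joins the points of [K_n] and [K_{1,n-1}]. Branching on
   a vertex, [F(G) <= F(G - v) + F(G - N[v])], and [n <= a (Delta + 1)] yield a
   Turan-type recursive bound on [F], at most [2^n (3/4)^(n - a)], which is below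
   the line when [n >= 15] and [n - a >= 3]. Connectedness enters only through
   [sum deg >= 2 (n - 1)]: every edge has an end outside a maximum stable set, so
   [n - 1 <= (n - a) Delta], and branching on a vertex of maximum degree settles
   [n - a <= 2]. For [8 <= n <= 14] one of the two bounds suffices, by
   computation, except for [(n, a) = (8, 4)], where one branches twice.

   Facets: over each abscissa in [[1, n - 1]] the polytope contains a point of the
   upper line and a point of some lower line. Hence a non-vertical supporting
   line which meets the polytope from above is the upper line; from below, the
   lower line touched at the midpoint of two points of the face contains both of
   them. Vertical supporting lines meet the polytope in a single point. *)
From HB Require Import structures.
Require Import Defs.
From mathcomp Require Import all_boot all_order all_algebra.
From mathcomp Require Import zify ring lra.
From mathcomp Require classical_sets.
Set Implicit Arguments.
Unset Strict Implicit.
Unset Printing Implicit Defensive.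

(** * Stable sets of finite graphs *)

Section Graph.
Variable G : sgraph.
Implicit Types (U S : {set G}) (v : G).

(** All notions are relative to a vertex set [U], so that branching changes only [U] and induced
    subgraphs stay inside [G]. *)
Definition stable_in U := [set S : {set G} | stable S & S \subset U].
Definition nstable U := #|stable_in U|.
Definition alpha_le U a := forall S, stable S -> S \subset U -> #|S| <= a.
Definition deg U v := #|[set u in U | edge v u]|.
Definition delete_nbhd U v := [set u in U | (u != v) && ~~ edge v u].

Lemma stableP S : reflect {in S &, forall x y, ~~ edge x y} (stable S).
Proof.
apply: (iffP forall_inP) => [h x y xS yS|h x xS].
  by move/forall_inP: (h x xS); apply.
by apply/forall_inP => y yS; apply: h.
Qed.

Lemma stableS S S' : S \subset S' -> stable S' -> stable S.
Proof.
by move=> /subsetP h /stableP h'; apply/stableP => x y /h ? /h ?; apply: h'.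
Qed.

Lemma stable1 v : stable [set v].
Proof. by apply/stableP => x y /set1P-> /set1P->; rewrite edge_irr. Qed.

Lemma stableU1 v S : stable S -> {in S, forall u, ~~ edge v u} ->
  stable (v |: S).
Proof.
move=> /stableP st vS; apply/stableP => x y /setU1P[->|xS] /setU1P[->|yS].
- by rewrite edge_irr.
- exact: vS.
- by rewrite edge_sym; apply: vS.
- exact: st.
Qed.

Lemma alpha_leS U U' a : U \subset U' -> alpha_le U' a -> alpha_le U a.
Proof. by move=> h h' S st /subset_trans/(_ h); apply: h'. Qed.

Lemma delete_nbhdS U v : delete_nbhd U v \subset U.
Proof. by apply/subsetP => x; rewrite inE => /andP[]. Qed.

(** A stable set avoiding the closed neighbourhood of [v] stays stable and grows by one when [v] is
    added. *)
Lemma alpha_le_delete U v a : v \in U ->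
  alpha_le U a.+1 -> alpha_le (delete_nbhd U v) a.
Proof.
move=> vU al S st sSU.
have vS : v \notin S.
  by apply/negP => /(subsetP sSU); rewrite inE eqxx andbF.
have := al (v |: S); rewrite cardsU1 vS ltnS; apply.
  by apply: stableU1 => // u /(subsetP sSU); rewrite inE => /and3P[].
rewrite subUset sub1set vU.
exact: subset_trans sSU (delete_nbhdS _ _).
Qed.

Lemma card_delete U v : v \in U -> #|delete_nbhd U v| + (deg U v).+1 = #|U|.
Proof.
move=> vU; rewrite (cardsD1 v U) vU add1n addnS; congr _.+1.
rewrite addnC -[RHS](cardsID [set u | edge v u]) /deg /delete_nbhd.
congr (_ + _); apply: eq_card => u; rewrite !inE.
  by case: (eqVneq u v) => [->|//]; rewrite edge_irr andbF.
by rewrite andbA andbC (andbC (u \in U)).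
Qed.

Lemma nstable_branch U v : v \in U ->
  nstable U <= nstable (U :\ v) + nstable (delete_nbhd U v).
Proof.
move=> vU; rewrite /nstable -(cardsID [set S : {set G} | v \in S]) addnC leq_add //.
  apply: subset_leq_card; apply/subsetP => S; rewrite !inE => /andP[vS /andP[-> sSU]].
  by rewrite subsetD1 sSU.
(* Removing [v] is injective on the stable sets that contain [v], and its values avoid the
   neighbours of [v]. *)
rewrite -[X in X <= _](card_in_imset (f := fun S : {set G} => S :\ v)).
  apply: subset_leq_card; apply/subsetP => ? /imsetP[S].
  rewrite !inE => /andP[/andP[st sSU] vS] ->.
  rewrite (stableS (subsetDl _ _) st); apply/subsetP => u.
  rewrite !inE => /andP[-> uS]; rewrite (subsetP sSU) //=.
  by move/stableP: st; apply.
move=> S S'; rewrite !inE => /andP[_ vS] /andP[_ vS'] e.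
by rewrite -(setD1K vS) e setD1K.
Qed.

(** Greedy argument: deleting a closed neighbourhood removes at most [d.+1] vertices and lowers the
    bound on stable sets by one. *)
Lemma leq_card_degree U a d : alpha_le U a ->
  {in U, forall v, deg U v <= d} -> #|U| <= a * d.+1.
Proof.
elim: a U => [|a IH] U al dg; have [->|[v vU]] := set_0Vmem U; rewrite ?cards0 //.
  by have := al _ (stable1 v); rewrite sub1set cards1 => /(_ vU).
rewrite -(card_delete vU) addnC mulSn leq_add ?ltnS ?dg //.
apply: IH; first exact: alpha_le_delete.
move=> u uU; apply: leq_trans (dg u (subsetP (delete_nbhdS _ _) u uU)).
apply: subset_leq_card; apply/subsetP => x; rewrite !inE.
by case/andP => /andP[-> _] ->.
Qed.

(* The value obtained by repeatedly branching on a vertex of degree at least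
   [n / a - 1]; this is the number of stable sets of a disjoint union of [a]
   cliques of nearly equal sizes and total order [n]. *)
Fixpoint turan_bound (a n : nat) {struct a} : nat :=
  if a is a'.+1 then
    (fix rec n := if n is n'.+1 then rec n' + turan_bound a' ((n * a') %/ a)
                  else 1) n
  else 1.

Lemma turan_boundS a n : turan_bound a.+1 n.+1 =
  turan_bound a.+1 n + turan_bound a ((n.+1 * a) %/ a.+1).
Proof. by []. Qed.

Lemma leq_turan_bound a : {homo turan_bound a : m n / m <= n}.
Proof.
apply: homo_leq => //; first by move=> ? ? ?; apply: leq_trans.
by case: a => // a n; rewrite turan_boundS leq_addr.
Qed.

Lemma nstable0 : nstable set0 = 1.
Proof.
rewrite /nstable -(cards1 (set0 : {set G})); apply: eq_card => S.
rewrite !inE subset0; case: eqVneq => [->|_]; rewrite ?andbF //.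
by rewrite andbT; apply/stableP => x y; rewrite inE.
Qed.

Lemma nstable_turan a n U : alpha_le U a -> #|U| <= n ->
  nstable U <= turan_bound a n.
Proof.
elim: a n U => [|a IHa] n U al.
  move=> _; have [->|[v vU]] := set_0Vmem U; first by rewrite nstable0.
  by have := al _ (stable1 v); rewrite sub1set cards1 => /(_ vU).
elim: n U al => [|n IHn] U al.
  by rewrite leqn0 cards_eq0 => /eqP->; rewrite nstable0.
rewrite leq_eqVlt => /predU1P[cU|]; last first.
  by move=> /(IHn _ al) h; rewrite turan_boundS (leq_trans h) ?leq_addr.
(* Otherwise a vertex of maximum degree would contradict [leq_card_degree]. *)
have [v vU dv] : exists2 v, v \in U & n.+1 <= a.+1 * (deg U v).+1.
  apply/exists_inP; apply: contraT => /exists_inPn h.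
  have: 0 < #|U| by rewrite cU.
  rewrite card_gt0 => /set0Pn [v0 v0U].
  have [k dk] : exists k, {in U, forall v, deg U v <= k} /\ a.+1 * k.+1 < n.+1.
    have [v vU vmax] := @arg_maxnP _ v0 (mem U) (deg U) v0U.
    by exists (deg U v); split; [move=> u /vmax|rewrite ltnNge h].
  by have := leq_card_degree al dk.1; rewrite cU leqNgt dk.2.
apply: leq_trans (nstable_branch vU) _; rewrite turan_boundS leq_add //.
  apply: IHn; first exact: alpha_leS (subsetDl _ _) al.
  by rewrite -ltnS -cU (cardsD1 v U) vU.
apply: IHa; first exact: alpha_le_delete.
(* The closed neighbourhood removed has [(deg U v).+1] vertices, at least a fraction [1 / a.+1] of
   all [n.+1]. *)
rewrite leq_divRL //; have := card_delete vU; rewrite cU; nia.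
Qed.

Lemma nstable_degree_bound a n d U v : alpha_le U a.+1 -> v \in U ->
  #|U| = n.+1 -> d <= deg U v ->
  nstable U <= turan_bound a.+1 n + turan_bound a (n - d).
Proof.
move=> al vU cU dv; apply: leq_trans (nstable_branch vU) _; rewrite leq_add //.
  apply: nstable_turan; first exact: alpha_leS (subsetDl _ _) al.
  by rewrite -ltnS -cU (cardsD1 v U) vU.
apply: nstable_turan; first exact: alpha_le_delete.
have := card_delete vU; lia.
Qed.

(** * Degree sums, connectedness and the lower bound on the Fibonacci index *)

Definition degsum U := \sum_(u in U) deg U u.

Lemma degE U v : deg U v = \sum_(u in U) edge v u.
Proof.
rewrite /deg -sum1dep_card big_mkcondr /=.
by apply: eq_bigr => u _; case: edge.
Qed.

(** Removing [v] costs its own degree, and one more at each of its neighbours. *)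
Lemma degsumD1 U v : v \in U -> degsum U = degsum (U :\ v) + 2 * deg U v.
Proof.
move=> vU; have degD u : deg U u = edge u v + deg (U :\ v) u.
  by rewrite !degE (big_setD1 v vU).
rewrite /degsum (big_setD1 v vU) /= (eq_bigr _ (fun u _ => degD u)) big_split /=.
have -> : \sum_(u in U :\ v) edge u v = deg U v.
  rewrite degD edge_irr degE; by apply: eq_bigr => u _; rewrite edge_sym.
by rewrite mul2n -addnn addnA addnC.
Qed.

Lemma degsum_le U d : {in U, forall v, deg U v <= d} -> degsum U <= #|U| * d.
Proof. by move=> h; rewrite /degsum -sum_nat_const leq_sum. Qed.

(** A vertex set is grown one vertex at a time, each new vertex being adjacent to an earlier one;
    every step adds at least 2 to the degree sum. *)
Lemma connected_degsum : connected_graph G -> 2 * (#|G| - 1) <= degsum [set: G].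
Proof.
move=> con; have [z _|e] := pickP (fun _ : G => true); last first.
  by rewrite (eq_card0 e).
have [k leG] : exists k, k.+1 = #|G|.
  by exists #|G|.-1; rewrite prednK // (cardD1 z).
have : exists2 U : {set G}, #|U| = k.+1 & 2 * k <= degsum U.
  have : k < #|G| by rewrite -leG.
  elim: k {leG} => [_|k IH lk]; first by exists [set z]; rewrite ?cards1.
  have [U cU dU] := IH (ltnW lk).
  have [x [w [xU wU xw]]] : exists x w, [/\ x \in U, w \notin U & edge x w].
    have /set0Pn[x xU] : U != set0 by rewrite -card_gt0 cU.
    have /subsetPn[y _ yU] : ~~ ([set: G] \subset U).
      by apply/negP => /subset_leq_card; rewrite cardsT cU leqNgt lk.
    have [/exists_inP[x' x'U /exists_inP[w wU e]]|no] :=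
      boolP [exists x' in U, exists w in ~: U, edge x' w].
      by exists x', w; split => //; rewrite inE in wU.
    (* If no edge leaves [U], then [U] is closed under [connect], although [x] lies in it and [y]
       does not. *)
    have cl : closed (@edge G) (mem U).
      apply: intro_closed; first exact/sym_connect_sym/edge_sym.
      move=> u w uw uU; apply: contraR no => wU.
      by apply/exists_inP; exists u => //; apply/exists_inP; exists w; rewrite ?inE.
    by have := closed_connect cl (con x y); rewrite xU (negPf yU).
  exists (w |: U); first by rewrite cardsU1 wU cU.
  rewrite (degsumD1 (setU11 w U)) setU1K // mulnS addnC leq_add // leq_pmulr //.
  rewrite card_gt0; apply/set0Pn; exists x.
  by rewrite !inE xU orbT edge_sym.
case=> U cU dU; have -> : [set: G] = U.
  by apply/eqP; rewrite eq_sym eqEcard subsetT cardsT cU leG /=.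
by rewrite -leG subn1.
Qed.

(* Every edge has an end outside the stable set [S]. *)
Lemma degsum_stable S : stable S ->
  degsum [set: G] <= 2 * \sum_(v in ~: S) deg [set: G] v.
Proof.
move=> /stableP st; rewrite /degsum (bigID (mem S)) /= mul2n -addnn.
under eq_bigl do rewrite in_setT andTb.
rewrite leq_add //; last by apply/eq_leq/eq_bigl => v; rewrite !inE.
under eq_bigr do rewrite degE.
have degT v : deg [set: G] v = \sum_(u : G) edge v u.
  by rewrite degE; apply: eq_bigl => u; rewrite inE.
(* Exchanging the sums counts each edge at [S] from its other end, which lies outside [S]. *)
rewrite exchange_big /= [X in _ <= X](eq_bigr _ (fun v _ => degT v)).
rewrite [X in X <= _](bigID (mem S)) /= big1 ?add0n; last first.
  move=> u /andP[_ uS]; rewrite big1 // => w wS.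
  by apply/eqP; rewrite eqb0; apply: st.
rewrite [X in X <= _](eq_bigl (mem (~: S))) => [|u]; last by rewrite !inE.
apply: leq_sum => v _; rewrite [X in _ <= X](bigID (mem S)) /=.
rewrite (eq_bigr (fun u => nat_of_bool (edge v u))) ?leq_addr // => u _.
by rewrite edge_sym.
Qed.

Lemma stability_numberP : exists2 S : {set G}, stable S & #|S| = stability_number G.
Proof.
have s0 : stable (set0 : {set G}) by apply/stableP => x y; rewrite inE.
have [S st Smax] := arg_maxnP (fun S : {set G} => #|S|) s0.
exists S => //; apply/eqP; rewrite eqn_leq leq_bigmax_cond //.
exact/bigmax_leqP.
Qed.

Lemma alpha_le_stability_number : alpha_le [set: G] (stability_number G).
Proof. move=> S st _. exact: (leq_bigmax_cond (F := fun S : {set G} => #|S|) S st). Qed.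

(** The left side counts a classical set, the right side a finite set; only membership has to be
    translated. *)
Lemma nstableT : fibonacci_index G = nstable [set: G].
Proof.
apply: eq_card => S; rewrite [RHS]inE subsetT andbT.
by apply/idP/idP => [/classical_sets.set_mem|st]; last exact: classical_sets.mem_set.
Qed.

Lemma fibonacci_ge : 2 ^ stability_number G + (#|G| - stability_number G) <=
  fibonacci_index G.
Proof.
have [S st <-] := stability_numberP.
rewrite -card_powerset -[#|G|]cardsT -(cardsID S [set: G]) setTI addKn.
rewrite -(card_imset (mem ([set: G] :\: S)) set1_inj) nstableT.
rewrite -cardsUI (_ : _ :&: _ = set0) ?cards0 ?addn0; last first.
  apply/setP => A; rewrite !inE; apply/negP => /andP[AS /imsetP[x]].
  by rewrite !inE andbT => xS e; rewrite e sub1set (negPf xS) in AS.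
apply: subset_leq_card; apply/subsetP => A.
rewrite !inE subsetT andbT => /orP[|/imsetP[x _ ->]].
  by move/stableS/(_ st).
exact: stable1.
Qed.

End Graph.

(** * The upper bound for connected graphs *)

Lemma turan_bound1 n : turan_bound 1 n = n.+1.
Proof. by elim: n => // n IH; rewrite turan_boundS IH addn1. Qed.

Lemma turan_bound_le_pow a n : turan_bound a n <= 2 ^ n.
Proof.
elim: a n => [|a IHa] n; first by rewrite expn_gt0.
elim: n => // n IHn; rewrite turan_boundS expnS mul2n -addnn leq_add //.
apply: leq_trans (IHa n); apply: leq_turan_bound.
by rewrite -ltnS ltn_divLR // ltn_mul2l /=.
Qed.

(** With [t = n - a.+1], the recursion gives at most [(3/4)^t (2^n + 2^(n-1))], which is
    [(3/4)^(t+1) 2^(n+1)]. Denominators are cleared to stay in the naturals. *)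
Lemma turan_bound_le_34 a n : a <= n ->
  4 ^ (n - a) * turan_bound a n <= 2 ^ n * 3 ^ (n - a).
Proof.
elim: a n => [|a IHa] n.
  by move=> _; case: n => // n; rewrite subn0 muln1 -expnMn leq_exp2r.
elim: n => // n IHn; rewrite ltnS leq_eqVlt => /predU1P[->|an].
  by rewrite subnn !mul1n muln1 turan_bound_le_pow.
have {IHn} := IHn an; have := IHa n.-1 ltac:(lia).
have -> : n.-1 - a = n - a.+1 by lia.
have -> : n.+1 - a.+1 = (n - a.+1).+1 by lia.
set t := n - a.+1 => h1 h2; rewrite turan_boundS.
(* Since [a < n], the quotient is less than [n]. *)
have h3 : turan_bound a ((n.+1 * a) %/ a.+1) <= turan_bound a n.-1.
  apply: leq_turan_bound; rewrite -ltnS prednK ?ltn_divLR; lia.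
have : 2 ^ n = 2 * 2 ^ n.-1 by rewrite -expnS prednK //; lia.
rewrite !expnS; set X := 2 ^ n.-1 in h1 *; set Y := 2 ^ n in h2 * => e.
rewrite e in h2 *.
have := leq_mul (leqnn (4 ^ t)) h3.
move: h1 h2 {h3}; set a1 := turan_bound _ _; set a2 := turan_bound _ _.
set a3 := turan_bound _ _; nia.
Qed.

(** The start 11 cannot be lowered: the inequality fails at [t = 10]. *)
Lemma two_mul_pow3 t : 11 <= t -> 2 * 3 ^ t * t <= 4 ^ t.
Proof.
elim: t => // t IH; rewrite leq_eqVlt => /predU1P[<-|]; first by vm_compute.
rewrite ltnS => t11; have := IH t11; rewrite !expnS; nia.
Qed.

(** For fixed [t] the inequality is linear in [n], which settles [t <= 10]. The threshold 15 comes
    from [t = 3], where it reads 702 <= 704, while [n = 14] would give 648 <= 640. *)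
Lemma pow34_le n t : 15 <= n -> 3 <= t -> t + 2 <= n ->
  2 * 3 ^ t * (n - 2) <= 4 ^ t * (n - t - 1).
Proof.
move=> n15 t3 tn; have [t11|t10] := leqP 11 t.
  have := two_mul_pow3 t11; have [j ->] : exists j, n = t + 2 + j.
    by exists (n - (t + 2)); lia.
  have -> : t + 2 + j - 2 = t + j by lia.
  have -> : t + 2 + j - t - 1 = j.+1 by lia.
  move: (3 ^ t) (4 ^ t) => x y h; nia.
have : t \in iota 3 8 by rewrite mem_iota; lia.
rewrite !inE; do 7 (case/predU1P=> [->|]; first by rewrite !(expnS, expn0); lia).
by move=> /eqP->; rewrite !(expnS, expn0); lia.
Qed.

(* [n - 2] times the right-hand side of the upper facet inequality at [x = a] *)
Definition upper_line n a := (n - 2) * (n + 1) + (a - 1) * (2 ^ (n - 1) - n).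

(** The terms of [upper_line] without the power of 2 have a nonnegative sum, because
    [a - 1 <= n - 2]. *)
Lemma leq_upper_line n a : 2 <= n -> 0 < a < n ->
  (a - 1) * 2 ^ (n - 1) <= upper_line n a.
Proof.
move=> n2 an; rewrite /upper_line mulnBr.
have : (a - 1) * n <= (n - 2) * (n + 1) by nia.
move: ((a - 1) * 2 ^ _) => X; lia.
Qed.

Lemma upper_line_turan n a : 15 <= n -> 1 <= a -> a + 3 <= n ->
  (n - 2) * turan_bound a n <= upper_line n a.
Proof.
(* For [a = 1] there is equality, at the complete graph, and [leq_upper_line] would be too weak. *)
move=> n15 a1 an; have [->|a2] := eqVneq a 1.
  by rewrite turan_bound1 /upper_line subnn mul0n addn0 addn1.
apply: leq_trans (leq_upper_line _ _); try lia.
have := @turan_bound_le_34 a n ltac:(lia).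
have := @pow34_le n (n - a) n15 ltac:(lia) ltac:(lia).
have -> : n - (n - a) - 1 = a - 1 by lia.
have -> : 2 ^ n = 2 * 2 ^ (n - 1) by rewrite -expnS; congr expn; lia.
have : 0 < 4 ^ (n - a) by rewrite expn_gt0.
move: (4 ^ _) (3 ^ _) (2 ^ _) (turan_bound _ _) (n - 2) (a - 1) => x y z T m b.
move=> x0 h1 h2; rewrite -(leq_pmul2l x0).
have := leq_mul (leqnn m) h2; have := leq_mul (leqnn z) h1; nia.
Qed.

(** The bound from one branching on a vertex of degree at least [d], followed by [turan_bound] on
    both sides. *)
Definition branch_bound n a d :=
  turan_bound a (n - 1) + turan_bound (a - 1) (n - 1 - d).

Lemma upper_line_branch n a d : 15 <= n -> a < n -> n <= a + 2 ->
  n - 1 <= (n - a) * d -> (n - 2) * branch_bound n a d <= upper_line n a.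
Proof.
move=> n15 an na nd; rewrite /branch_bound.
have [|] : a = n - 1 \/ a = n - 2 by lia.
  (* Here [d >= n - 1], so nothing remains after deleting the closed neighbourhood; the resulting
     bound is the value of the star, which lies on the line. *)
  move=> ea; have -> : n - 1 - d = 0 by nia.
  have -> : turan_bound (a - 1) 0 = 1 by case: (a - 1).
  have := turan_bound_le_pow a (n - 1).
  have : n <= 2 ^ (n - 1) by have := @ltn_expl 2 (n - 1) isT; lia.
  rewrite /upper_line {}ea; move: (turan_bound _ _) (2 ^ _) => x y; nia.
move=> ea; apply: leq_trans (leq_upper_line _ _); try lia.
have := @turan_bound_le_34 a (n - 1) ltac:(lia).
have := turan_bound_le_pow (a - 1) (n - 1 - d).
(* Now [d >= 3], so both terms together are at most [(6 + 1) 2^(n-4)], and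
   [7 (n - 2) <= 8 (n - 3)]. *)
have : 2 ^ (n - 1 - d) <= 2 ^ (n - 4) by rewrite leq_exp2l //; nia.
have -> : n - 1 - a = 1 by lia.
have -> : 2 ^ (n - 1) = 8 * 2 ^ (n - 4).
  by rewrite -[8]/(2 ^ 3) -expnD; congr expn; lia.
rewrite {}ea !expn1; move: (2 ^ _) (2 ^ _) (turan_bound _ _) (turan_bound _ _); nia.
Qed.

Definition ceil_div m t := (m + t - 1) %/ t.

(** At [(8, 4)] the two bounds are 81 and 72, both above the value 69 of the line. *)
Lemma small_order_bound n a : 8 <= n <= 14 -> 1 <= a < n -> (n, a) != (8, 4) ->
  ((n - 2) * turan_bound a n <= upper_line n a) ||
  ((n - 2) * branch_bound n a (ceil_div (n - 1) (n - a)) <= upper_line n a).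
Proof.
move=> hn ha na.
suff /allP /(_ n) : all (fun n => all (fun a => ((n, a) == (8, 4)) ||
  ((n - 2) * turan_bound a n <= upper_line n a) ||
  ((n - 2) * branch_bound n a (ceil_div (n - 1) (n - a)) <= upper_line n a))
    (iota 1 (n - 1))) (iota 8 7).
  rewrite mem_iota => /(_ ltac:(lia)) /allP /(_ a).
  by rewrite mem_iota (negPf na) => /(_ ltac:(lia)).
by vm_compute.
Qed.

Section Bound.
Variable G : sgraph.
Hypothesis conG : connected_graph G.
Let n := #|G|.
Let a := stability_number G.

Lemma stability_gt0 : 0 < n -> 0 < a.
Proof.
case/card_gt0P => x _.
by have := alpha_le_stability_number (stable1 x) (subsetT _); rewrite cards1.
Qed.

Lemma exists_large_degree : 0 < n ->
  exists v : G, n - 1 <= (n - a) * deg [set: G] v.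
Proof.
case/card_gt0P => x0 _.
have [v _ vmax] := @arg_maxnP _ x0 xpredT (deg [set: G]) isT; exists v.
have [S stS cS] := stability_numberP G.
rewrite -(leq_pmul2l (isT : 0 < 2)); apply: leq_trans (connected_degsum conG) _.
apply: leq_trans (degsum_stable stS) _; rewrite leq_pmul2l // /a -cS.
have -> : n - #|S| = #|~: S| by rewrite -[n](cardsC S) addKn.
by rewrite -sum_nat_const; apply: leq_sum => u _; apply: vmax.
Qed.

Lemma stability_lt : 2 <= n -> a < n.
Proof.
(* If [a >= n], the truncated difference [n - a] is 0, forcing [n - 1 <= 0]. *)
move=> n2; have [v] := exists_large_degree (ltnW n2); nia.
Qed.

Lemma fibonacci_branch d (v : G) : 0 < a -> d <= deg [set: G] v ->
  fibonacci_index G <= branch_bound n a d.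
Proof.
move=> a0 dv; have n0 : 0 < n by apply/card_gt0P; exists v.
have := alpha_le_stability_number (G := G); rewrite nstableT /branch_bound !subn1 -/a.
case: a a0 => // b _ al; apply: (nstable_degree_bound al (in_setT v)) => //.
by rewrite cardsT prednK.
Qed.

Lemma fibonacci_8_4 : n = 8 -> a = 4 -> fibonacci_index G <= 69.
Proof.
move=> n8 a4; have n0 : 0 < n by rewrite n8.
have [v] := exists_large_degree n0; rewrite n8 a4 => dv.
have al : alpha_le [set: G] 4 by rewrite -a4; apply: alpha_le_stability_number.
(* From [7 <= 4 * deg] the degree of [v] is at least 2. Degree 3 or more needs a single branching;
   otherwise it is exactly 2. *)
have [d3|d2] := leqP 3 (deg [set: G] v).
  apply: leq_trans (fibonacci_branch _ d3) _; first by rewrite a4.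
  by rewrite n8 a4; vm_compute.
pose U := [set: G] :\ v.
have cU : #|U| = 7 by move: n8; rewrite /n -cardsT (cardsD1 v) in_setT => -[].
(* Removing [v] lowers the degree sum from at least 14 to at least 10, more than the 7 remaining
   vertices allow with degrees at most 1. *)
have [u uU du] : exists2 u, u \in U & 2 <= deg U u.
  apply/exists_inP; apply: contraT => /exists_inPn h.
  have := connected_degsum conG; rewrite (degsumD1 (in_setT v)) -/n -/U n8.
  have : degsum U <= 7 * 1.
    by rewrite -cU degsum_le // => u /h; rewrite -ltnNge.
  by lia.
rewrite nstableT; apply: leq_trans (nstable_branch (in_setT v)) _.
apply: (@leq_trans (48 + 18)) => //; apply: leq_add.
  have alU : alpha_le U 4 := alpha_leS (subsetDl _ _) al.
  by apply: leq_trans (nstable_degree_bound alU uU cU du) _; vm_compute.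
apply: (@leq_trans (turan_bound 3 5)); last by vm_compute.
apply: nstable_turan; first exact: alpha_le_delete (in_setT v) al.
have := card_delete (in_setT v); rewrite cardsT -/n n8; lia.
Qed.

Lemma fibonacci_le : 8 <= n -> (n - 2) * fibonacci_index G <= upper_line n a.
Proof.
move=> n8; have n0 : 0 < n by lia.
have a0 := stability_gt0 n0; have an := @stability_lt ltac:(lia).
have [v dv] := exists_large_degree n0.
have turan : fibonacci_index G <= turan_bound a n.
  by rewrite nstableT nstable_turan ?cardsT //; apply: alpha_le_stability_number.
have [n15|n14] := leqP 15 n.
  have [a3|a2] := leqP (a + 3) n.
    by apply: leq_trans (upper_line_turan _ _ _) => //; rewrite leq_mul2l turan orbT.
  apply: leq_trans (upper_line_branch n15 an _ dv); last lia.
  by rewrite leq_mul2l (fibonacci_branch a0 (leqnn _)) orbT.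
have [[en ea]|ne] := eqVneq (n, a) (8, 4).
  have -> : upper_line n a = 6 * 69 by rewrite en ea; vm_compute.
  by rewrite en leq_mul2l fibonacci_8_4.
have /orP[] := @small_order_bound n a ltac:(lia) ltac:(lia) ne; apply: leq_trans.
  by rewrite leq_mul2l turan orbT.
rewrite leq_mul2l (@fibonacci_branch _ v) ?orbT //.
rewrite -ltnS ltn_divLR; nia.
Qed.
End Bound.

(** * Complete split graphs *)

Section SplitGraph.
Variables n k : nat.
Hypotheses (k_gt0 : 0 < k) (k_lt : k < n).

Definition split_edge : rel 'I_n :=
  fun x y => (x != y) && ((k <= x) || (k <= y)).

Lemma split_edge_sym : symmetric split_edge.
Proof. by move=> x y; rewrite /split_edge eq_sym orbC. Qed.

Lemma split_edge_irr : irreflexive split_edge.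
Proof. by move=> x; rewrite /split_edge eqxx. Qed.

Definition split_graph : sgraph := SGraph split_edge_sym split_edge_irr.

Lemma split_graph_connected : connected_graph split_graph.
Proof.
(* The vertex [k] is adjacent to every other vertex. *)
have toz (x : split_graph) : connect (@edge split_graph) x (Ordinal k_lt : 'I_n).
  have [->|ne] := eqVneq x (Ordinal k_lt : 'I_n); first exact: connect0.
  by apply: connect1; rewrite /edge /= /split_edge ne /= leqnn orbT.
move=> x y; apply: connect_trans (toz x) _.
by rewrite (sym_connect_sym split_edge_sym); apply: toz.
Qed.

Let low : {set split_graph} := [set x : 'I_n | x < k].

Let card_low : #|low| = k.
Proof.
rewrite /low cardsE -sum1_card (big_ord_narrow (ltnW k_lt)).
by rewrite sum1_card card_ord.
Qed.

Let stable_low : stable low.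
Proof.
apply/stableP => x y; rewrite !inE => xk yk.
by rewrite /edge /= /split_edge leqNgt xk leqNgt yk andbF.
Qed.

(** A vertex outside [low] is adjacent to all others, so a stable set containing it is a
    singleton. *)
Let stable_split (S : {set split_graph}) : stable S ->
  (S \subset low) || [exists x in ~: low, S == [set x]].
Proof.
move=> /stableP st; rewrite orbC -implyNb; apply/implyP => /exists_inPn no.
apply/subsetP => x xS; apply: contraT => xl; have := no x.
rewrite inE => /(_ xl) /eqP[]; apply/eqP; rewrite eqEsubset sub1set xS andbT.
apply/subsetP => y yS; rewrite inE; apply: contraT => ne.
have := st _ _ yS xS; rewrite /edge /= /split_edge ne /=.
by move: xl; rewrite inE -leqNgt => ->; rewrite orbT.
Qed.

Lemma split_graph_stability : stability_number split_graph = k.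
Proof.
apply/eqP; rewrite eqn_leq; apply/andP; split; last first.
  by rewrite -{1}card_low; apply: alpha_le_stability_number.
have [S st <-] := stability_numberP split_graph.
have /orP[/subset_leq_card|/exists_inP[x _ /eqP->]] := stable_split st.
  by rewrite card_low.
(* A singleton has size at most [k] by [k_gt0]. *)
by rewrite cards1.
Qed.

Lemma split_graph_fibonacci : fibonacci_index split_graph = 2 ^ k + (n - k).
Proof.
have cn : #|split_graph| = n by rewrite card_ord.
apply/eqP; rewrite eqn_leq; apply/andP; split; last first.
  have := fibonacci_ge split_graph.
  by rewrite split_graph_stability cn.
rewrite nstableT.
have -> : 2 ^ k + (n - k) = #|powerset low| + #|set1 @: ~: low|.
  rewrite card_powerset card_low (card_imset _ set1_inj); congr (_ + _).
  by rewrite -{1}cn -(cardsC low) card_low addKn.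
apply: leq_trans (leq_card_setU _ _); apply: subset_leq_card.
apply/subsetP => S; rewrite 3!inE => /andP[/stable_split + _].
case/orP=> [->//|/exists_inP[x xl /eqP->]].
by apply/orP; right; apply: imset_f.
Qed.

End SplitGraph.

(** * Convex hulls, affine rank and lines in the plane *)

From mathcomp Require Import classical_sets cardinality reals convex.
From mathcomp Require Import interval_inference.
Import Order.TTheory GRing.Theory Num.Theory.
Local Open Scope classical_set_scope.
Local Open Scope card_scope.
Local Open Scope ring_scope.

Section ConvexHull.
Variables (R : realType) (V : lmodType R).
Implicit Types (A X : set V) (p q : V).

Lemma conv_hull_segment A p q (t : R) : conv_hull A p -> conv_hull A q ->
  0 <= t -> t <= 1 -> conv_hull A (t *: p + (1 - t) *: q).
Proof.
move=> Ap Aq t0 t1 X [cX AX]; apply: set_mem.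
by apply: (cX p q (Itv01 t0 t1)); apply: mem_set; [apply: Ap|apply: Aq].
Qed.

(** A half-space is convex, hence contains the hull of any set it contains. *)
Lemma conv_hull_le A (c : {linear V -> R^o}) (d : R) :
  (forall p, A p -> c p <= d) -> forall p, conv_hull A p -> c p <= d.
Proof.
move=> Ad; apply: smallest_sub => // p q t /set_mem pd /set_mem qd.
apply: mem_set; rewrite /= linearD !linearZ /=.
have t0 : 0 <= t%:num by []. have t1 : t%:num <= 1 by [].
rewrite -[_ *: c p]/(t%:num * c p) -[_ *: c q]/((1 - t%:num) * c q).
move: pd qd t0 t1; rewrite /=; move: t%:num (c p) (c q) => u x y; nra.
Qed.

Lemma affine_rank_uniq A k l : affine_rank A k -> affine_rank A l -> k = l.
Proof.
move=> [[p [Ap ip]] mk] [[q [Aq iq]] ml].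
by apply/eqP; rewrite eqn_leq (ml _ p) // (mk _ q).
Qed.

(** More than [k] rows of length [k] are linearly dependent, and by hypothesis such a relation is an
    affine dependency of the points. *)
Lemma affinely_independent_le m k (p : 'I_m -> V) (f : 'I_m -> 'rV[R]_k) :
  affinely_independent p ->
  (forall l : 'I_m -> R, \sum_i l i *: f i = 0 ->
     \sum_i l i = 0 /\ \sum_i l i *: p i = 0) ->
  (m <= k)%N.
Proof.
move=> ip fp; pose M := \matrix_i f i; rewrite leqNgt; apply/negP => km.
have : kermx M != 0.
  by rewrite kermx_eq0 /row_free neq_ltn (leq_ltn_trans (rank_leq_col M) km).
case/rowV0Pn => u /sub_kermxP uM /eqP; apply; apply/rowP => i.
have [|l0 lp] := fp (u 0); last by rewrite (ip _ l0 lp) mxE.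
by rewrite -[RHS]uM mulmx_sum_row; apply: eq_bigr => j _; rewrite rowK.
Qed.

End ConvexHull.

Section Plane.
Variable R : realType.
Local Notation plane := (R^o * R^o)%type.
Implicit Types (p q : plane) (A F : set plane).

Lemma plane_eq p q : p.1 = q.1 -> p.2 = q.2 -> p = q.
Proof. by case: p q => [? ?] [? ?] /= -> ->. Qed.

Definition functional (a b : R) (p : plane) : R^o := a * p.1 + b * p.2.

Lemma functional_is_linear a b : linear (functional a b).
Proof.
move=> t p q; rewrite /functional /= -![_ *: _]/(t * _); ring.
Qed.

HB.instance Definition _ a b :=
  GRing.isLinear.Build R plane R^o *:%R (functional a b) (functional_is_linear a b).

Lemma functionalE (c : {linear plane -> R^o}) p :
  c p = functional (c (1, 0)) (c (0, 1)) p.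
Proof.
have e : p = p.1 *: ((1, 0) : plane) + p.2 *: ((0, 1) : plane).
  by apply: plane_eq; rewrite /= -![_ *: _]/(_ * _ : R) mulr1 mulr0 ?addr0 ?add0r.
rewrite {1}e linearD !linearZ /= /functional.
by rewrite -![_ *: _]/(_ * _) mulrC [X in _ + X]mulrC.
Qed.

Lemma sum_fst m (l : 'I_m -> R) (p : 'I_m -> plane) :
  (\sum_i l i *: p i).1 = \sum_i l i * (p i).1.
Proof. by rewrite (raddf_sum fst). Qed.

Lemma sum_snd m (l : 'I_m -> R) (p : 'I_m -> plane) :
  (\sum_i l i *: p i).2 = \sum_i l i * (p i).2.
Proof. by rewrite (raddf_sum snd). Qed.

Lemma affinely_independent_plane m (p : 'I_m -> plane) :
  affinely_independent p -> (m <= 3)%N.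
Proof.
move=> ip.
(* Homogeneous coordinates [(1, x, y)]. *)
pose f i : 'rV[R]_3 := \row_(j < 3) nth 0 [:: 1; (p i).1; (p i).2] j.
apply: (affinely_independent_le (f := f) ip) => l e.
have E (j : 'I_3) : \sum_i l i * nth 0 [:: 1; (p i).1; (p i).2] j = 0.
  have := congr1 (fun u : 'rV[R]_3 => u 0 j) e.
  rewrite /= summxE mxE => e0.
  by rewrite -[RHS]e0; apply: eq_bigr => i _; rewrite !mxE.
split; first by rewrite -[RHS](E 0); apply: eq_bigr => i _; rewrite mulr1.
apply: plane_eq.
  by rewrite sum_fst; apply: (E 1).
by rewrite sum_snd; apply: (E 2%:R).
Qed.

Definition line (s t : R) : set plane := [set p | p.2 = s * p.1 + t].

Lemma affinely_independent_line m (p : 'I_m -> plane) s t :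
  (forall i, line s t (p i)) -> affinely_independent p -> (m <= 2)%N.
Proof.
move=> pl ip.
(* On a non-vertical line the ordinate is affine in the abscissa, so the rows [(1, x)] suffice. *)
pose f i : 'rV[R]_2 := \row_(j < 2) nth 0 [:: 1; (p i).1] j.
apply: (affinely_independent_le (f := f) ip) => l e.
have E (j : 'I_2) : \sum_i l i * nth 0 [:: 1; (p i).1] j = 0.
  have := congr1 (fun u : 'rV[R]_2 => u 0 j) e.
  rewrite /= summxE mxE => e0.
  by rewrite -[RHS]e0; apply: eq_bigr => i _; rewrite !mxE.
have l0 : \sum_i l i = 0.
  by rewrite -[RHS](E 0); apply: eq_bigr => i _; rewrite mulr1.
have l1 : \sum_i l i * (p i).1 = 0 by exact: (E 1).
split=> //; apply: plane_eq; rewrite ?sum_fst ?sum_snd //.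
under eq_bigr do rewrite pl mulrDr mulrCA.
by rewrite big_split /= -mulr_sumr l1 mulr0 -mulr_suml l0 mul0r addr0.
Qed.

Lemma barycentric (a b x y : R) :
  a + b = 0 -> a * x + b * y = 0 -> x != y -> a = 0.
Proof.
move=> /eqP; rewrite addr_eq0 => /eqP-> e xy; have /eqP : b * (y - x) = 0 by nra.
by rewrite mulf_eq0 subr_eq0 (eq_sym y) (negPf xy) orbF => /eqP->; rewrite oppr0.
Qed.

Lemma affine_rank_line A s t p q : A `<=` line s t -> A p -> A q ->
  p.1 != q.1 -> affine_rank A 2.
Proof.
move=> Al Ap Aq pq; split; last first.
  by move=> m r Ar; apply: (@affinely_independent_line _ _ s t) => i; apply/Al/Ar.
exists (fun i : 'I_2 => if i == 0 then p else q); split.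
  by move=> i; case: ifP.
move=> l; rewrite !big_ord_recl !big_ord0 /= !addr0.
move=> e /(congr1 fst) /=; rewrite -![_ *: _]/(_ * _) => e1.
have e2 : l ord0 = 0 by apply: barycentric e e1 pq.
move=> i; case: (eqVneq i ord0) => [->//|i0]; have -> : i = lift ord0 ord0.
  by apply/val_inj; case: i i0 => [[|[|]]].
by move: e; rewrite e2 add0r.
Qed.

(** Distinct points of a non-vertical line have distinct abscissae, which forces [a = - b * s] and
    [d = b * t]. *)
Lemma line_functional p q s t (a b d : R) : line s t p -> line s t q ->
  p != q -> functional a b p = d -> functional a b q = d -> b != 0 ->
  [set r | functional a b r = d] = line s t.
Proof.
rewrite /line /functional /= => lp lq pq cp cq b0.
have x0 : p.1 - q.1 != 0.
  apply: contra_neq pq => /eqP; rewrite subr_eq0 => /eqP e.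
  by apply: plane_eq => //; rewrite lp lq e.
have ea : a = - b * s.
  have /eqP : (a + b * s) * (p.1 - q.1) = 0 by rewrite lp lq in cp cq; nra.
  by rewrite mulf_eq0 (negPf x0) orbF addr_eq0 mulNr => /eqP.
have ed : d = b * t by rewrite -cp lp ea; ring.
apply/seteqP; split => r /= e.
  have /eqP : b * (r.2 - (s * r.1 + t)) = 0 by rewrite ea ed in e; lra.
  by rewrite mulf_eq0 (negPf b0) subr_eq0 => /eqP.
by rewrite e ea ed; ring.
Qed.

End Plane.

(** * The polytope *)

Section Polytope.
Variables (R : realType) (n : nat).
Hypothesis n_ge8 : (8 <= n)%N.
Local Notation plane := (R^o * R^o)%type.
Local Notation P := (connected_polytope R n).
Local Notation N := (n%:R : R).

(** Slope and intercept of the chord of [2^x - x + n] between [k] and [k + 1]. *)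
Definition low_slope (k : nat) : R := 2 ^+ k - 1.
Definition low_const (k : nat) : R := 2 ^+ k * (1 - k%:R) + N.
Definition up_slope : R := (2 ^+ (n - 1)%N - N) / (N - 2).
Definition up_const : R := N + 1 - up_slope.
Definition split_point (k : nat) : plane := (k%:R, 2 ^+ k - k%:R + N).

Let N8 : 8 <= N. Proof. by rewrite (ler_nat R 8 n). Qed.

Let pred_n : (n - 1)%:R = N - 1. Proof. by rewrite natrB //; lia. Qed.

Lemma polytope_le (a b d : R) :
  (forall G : sgraph, connected_graph G -> #|G| = n ->
    a * (stability_number G)%:R + b * (fibonacci_index G)%:R <= d) ->
  forall p, P p -> functional a b p <= d.
Proof.
move=> h; apply: conv_hull_le => -[x y] [G [cG oG /= ex ey]].
by rewrite /functional /= -ex -ey; apply: h.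
Qed.

Lemma split_point_polytope k : (0 < k < n)%N -> P (split_point k).
Proof.
move=> /andP[k0 kn]; apply: sub_gen_smallest; exists (split_graph n k); split => /=.
- exact: split_graph_connected.
- by rewrite card_ord.
- by rewrite split_graph_stability.
- rewrite split_graph_fibonacci // natrD natrX natrB ?(ltnW kn) //; ring.
Qed.

Lemma split_point_low k : line (low_slope k) (low_const k) (split_point k).
Proof. by rewrite /line /= /low_slope /low_const; ring. Qed.

Lemma split_point_lowS k : line (low_slope k) (low_const k) (split_point k.+1).
Proof.
by rewrite /line /= /low_slope /low_const exprS -[k.+1%:R]natr1; ring.
Qed.

Lemma split_point_up1 : line up_slope up_const (split_point 1).
Proof. by rewrite /line /= /up_const expr1; ring. Qed.

Lemma split_point_up_last : line up_slope up_const (split_point (n - 1)).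
Proof.
rewrite /line /= /up_const /up_slope pred_n; field.
by move: N8; set x := n%:R => h; apply/eqP; lra.
Qed.

(** The left side is the chord of [2^x] over [[k, k + 1]] evaluated at [a]. For [a >= k] the claim
    is [1 + m <= 2^m] with [m = a - k]; for [a < k] the left side is not positive. *)
Lemma pow_tangent k a : (2 ^+ k * (1 + a%:R - k%:R) : R) <= 2 ^+ a.
Proof.
have [ka|ak] := leqP k a; last first.
  apply: (@le_trans _ _ 0); last by rewrite exprn_ge0.
  by rewrite mulr_ge0_le0 ?exprn_ge0 // subr_le0 nat1r ler_nat.
rewrite -{2}(subnKC ka) exprD ler_pM2l ?exprn_gt0 //.
have -> : 1 + a%:R - k%:R = (a - k).+1%:R :> R.
  by rewrite -natr1 natrB //; ring.
by rewrite -natrX ler_nat ltn_expl.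
Qed.

Section OneGraph.
Variable G : sgraph.
Hypotheses (conG : connected_graph G) (ordG : #|G| = n).
Let a := stability_number G.

Let a_gt0 : (0 < a)%N.
Proof. by apply: stability_gt0; rewrite ordG; lia. Qed.

Let a_lt : (a < n)%N.
Proof. by rewrite -ordG stability_lt // ordG; lia. Qed.

Lemma graph_low k :
  low_slope k * a%:R + - (fibonacci_index G)%:R <= - low_const k.
Proof.
have := fibonacci_ge G; rewrite -/a ordG -(ler_nat R) natrD natrX natrB ?(ltnW a_lt) //.
have := pow_tangent k a; rewrite /low_slope /low_const.
move: (2 ^+ k) (2 ^+ a) => x y; lra.
Qed.

Lemma graph_up : - up_slope * a%:R + (fibonacci_index G)%:R <= up_const.
Proof.
have := @fibonacci_le G conG; rewrite ordG -/a => /(_ n_ge8).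
(* This makes the truncated subtraction in [upper_line] a genuine one over [R]. *)
have n2 : (n <= 2 ^ (n - 1))%N by have := @ltn_expl 2 (n - 1) isT; lia.
rewrite /upper_line -(ler_nat R) !(natrD, natrM) !natrB ?natrX //; try lia.
rewrite /up_const /up_slope; move: N8.
set f := (fibonacci_index G)%:R; set x := n%:R => x8.
set y := 2 ^+ _ => h.
have x2 : 0 < x - 2 by lra.
rewrite -(ler_pM2l x2); set z := (y - x) / (x - 2).
have e : (x - 2) * z = y - x by rewrite mulrC divfK // gt_eqF.
have -> : (x - 2) * (- z * a%:R + f) = - ((x - 2) * z) * a%:R + (x - 2) * f by ring.
have -> : (x - 2) * (x + 1 - z) = (x - 2) * (x + 1) - (x - 2) * z by ring.
rewrite e; move: h; lra.
Qed.

Lemma graph_range : 1 <= a%:R :> R /\ a%:R <= N - 1.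
Proof.
by rewrite -pred_n ler1n ler_nat; split; [exact: a_gt0|have := a_lt; lia].
Qed.

End OneGraph.

Lemma polytope_low k p : P p -> low_slope k * p.1 + low_const k <= p.2.
Proof.
move=> Pp; have : functional (low_slope k) (-1) p <= - low_const k.
  apply: polytope_le Pp => G cG oG; rewrite mulN1r; exact: graph_low.
by case: p {Pp} => x y; rewrite /functional /=; move: x y => /= x y h; lra.
Qed.

Lemma polytope_up p : P p -> p.2 <= up_slope * p.1 + up_const.
Proof.
move=> Pp; have : functional (- up_slope) 1 p <= up_const.
  apply: polytope_le Pp => G cG oG; rewrite mul1r; exact: graph_up.
by case: p {Pp} => x y; rewrite /functional /=; move: x y => /= x y h; lra.
Qed.

Lemma polytope_range p : P p -> 1 <= p.1 /\ p.1 <= N - 1.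
Proof.
move=> Pp; split.
  have : functional (-1) 0 p <= -1.
    apply: polytope_le Pp => G cG oG; have [h _] := graph_range cG oG.
    by rewrite mul0r; move: h; lra.
  by case: p {Pp} => x y; rewrite /functional /=; move: x y => /= x y h; lra.
have : functional 1 0 p <= N - 1.
  apply: polytope_le Pp => G cG oG; have [_ h] := graph_range cG oG.
  by rewrite mul0r; move: h; lra.
by case: p {Pp} => x y; rewrite /functional /=; move: x y => /= x y h; lra.
Qed.

(** An integer part capped at [m.+1], so that the right end [m + 2] belongs to the last unit
    interval. *)
Lemma between_nat (x : R) m : 1 <= x -> x <= m%:R + 2 ->
  exists2 k, (1 <= k <= m.+1)%N & k%:R <= x /\ x <= k%:R + 1.
Proof.
move=> x1; elim: m => [|m IH] xm.
  by exists 1%N => //; split => //; move: xm; lra.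
have [/IH [k km kx]|mx] := leP x (m%:R + 2); first by exists k => //; lia.
exists m.+2; first lia.
by move: xm mx; rewrite -!natr1; lra.
Qed.

Lemma low_point_polytope (x : R) : 1 <= x -> x <= N - 1 ->
  exists2 k, (1 <= k <= n - 2)%N &
    P ((x, low_slope k * x + low_const k) : plane).
Proof.
move=> x1 xn; have [|k kn [kx xk]] := @between_nat x (n - 3) x1.
  by rewrite natrB; [move: xn; lra|lia].
exists k; first lia.
have -> : ((x, low_slope k * x + low_const k) : plane) =
  (k%:R + 1 - x) *: split_point k + (1 - (k%:R + 1 - x)) *: split_point k.+1.
  apply: plane_eq => /=; rewrite -![_ *: _]/(_ * _ : R).
    by rewrite -natr1; ring.
  by rewrite /low_slope /low_const exprS -natr1; ring.
apply: conv_hull_segment; try lra; apply: split_point_polytope; lia.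
Qed.

Lemma up_point_polytope (x : R) : 1 <= x -> x <= N - 1 ->
  P ((x, up_slope * x + up_const) : plane).
Proof.
move=> x1 xn; have N2 : N - 2 != 0 by apply/eqP; move: N8; lra.
have -> : ((x, up_slope * x + up_const) : plane) =
  ((N - 1 - x) / (N - 2)) *: split_point 1 +
  (1 - (N - 1 - x) / (N - 2)) *: split_point (n - 1).
  apply: plane_eq => /=; rewrite -![_ *: _]/(_ * _ : R).
    by rewrite pred_n; field.
  by rewrite /up_const /up_slope pred_n expr1; field.
apply: conv_hull_segment.
- by apply: split_point_polytope; lia.
- by apply: split_point_polytope; lia.
- by rewrite divr_ge0 //; move: N8; lra.
- by rewrite ler_pdivrMr; move: N8; lra.
Qed.

(** Up to the shift by [N], the points are (1, 1), (2, 2) and (3, 5), which are not collinear. *)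
Lemma moments_eq0 (a b c : R) : a + (b + c) = 0 ->
  a * 1%:R + (b * 2%:R + c * 3%:R) = 0 ->
  a * (2 ^+ 1 - 1%:R + N) + (b * (2 ^+ 2 - 2%:R + N) + c * (2 ^+ 3 - 3%:R + N)) = 0 ->
  a = 0 /\ b = 0 /\ c = 0.
Proof.
move=> e0 e1 e2; have {}e2 : a + b * 2 + c * 5 = 0.
  have : (a + (b + c)) * N = 0 by rewrite e0 mul0r.
  by move: e2; rewrite !exprS expr0; lra.
by split; [|split]; lra.
Qed.

Lemma polytope_rank : affine_rank P 3.
Proof.
split; last by move=> m p _; apply: affinely_independent_plane.
exists (fun i : 'I_3 => split_point i.+1); split.
  by move=> i; apply: split_point_polytope; have := ltn_ord i; lia.
move=> l; rewrite !big_ord_recl !big_ord0 /= !addr0 => e0 e.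
have := congr1 snd e; have := congr1 fst e.
rewrite /= -![_ *: _]/(_ * _ : R) => e1 e2.
have [l0 [l1 l2]] := moments_eq0 e0 e1 e2.
case=> [[|[|[|]]]] // h; [rewrite -l0|rewrite -l1|rewrite -l2];
  by congr (l _); apply/val_inj.
Qed.

(** * Determination of the facets *)

Lemma line_facet (a b d s t : R) (p q : plane) :
  (forall r, P r -> functional a b r <= d) ->
  [set r | functional a b r = d] = line s t ->
  P p -> P q -> line s t p -> line s t q -> p.1 != q.1 ->
  facets P (P `&` line s t).
Proof.
move=> Pd eq_line Pp Pq lp lq pq; split.
  by exists (functional a b), d; rewrite eq_line.
exists 2%N; split; first exact: polytope_rank.
by apply: (affine_rank_line (s := s) (t := t) (p := p) (q := q)) => // r [].
Qed.

Definition low_line k := line (low_slope k) (low_const k).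
Definition up_line := line up_slope up_const.

Lemma low_facet k : (1 <= k <= n - 2)%N -> facets P (P `&` low_line k).
Proof.
move=> kn; apply: (@line_facet (low_slope k) (-1) (- low_const k) _ _
  (split_point k) (split_point k.+1)).
- by move=> r Pr; apply: polytope_le Pr => G cG oG; rewrite mulN1r; apply: graph_low.
- apply/seteqP; split=> -[x y]; rewrite /line /functional /=;
    by move: x y => /= x y h; lra.
- by apply: split_point_polytope; lia.
- by apply: split_point_polytope; lia.
- exact: split_point_low.
- exact: split_point_lowS.
- by rewrite /= eqr_nat; lia.
Qed.

Lemma up_facet : facets P (P `&` up_line).
Proof.
apply: (@line_facet (- up_slope) 1 up_const _ _ (split_point 1) (split_point (n - 1))).
- by move=> r Pr; apply: polytope_le Pr => G cG oG; rewrite mul1r; apply: graph_up.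
- apply/seteqP; split=> -[x y]; rewrite /line /functional /=;
    by move: x y => /= x y h; lra.
- by apply: split_point_polytope; lia.
- by apply: split_point_polytope; lia.
- exact: split_point_up1.
- exact: split_point_up_last.
- by rewrite /= eqr_nat; lia.
Qed.

(** At abscissa 1 the upper line meets the lower line of index 1. *)
Lemma polytope_fst_min p : P p -> p.1 = 1 -> p = split_point 1.
Proof.
move=> Pp p1; apply: plane_eq; first by rewrite p1.
have := polytope_up Pp; have := polytope_low 1 Pp.
have := split_point_low 1; have := split_point_up1.
rewrite /line /= p1; move: (_ *1) (_ * 1) (p.2) => /= *; lra.
Qed.

(** At abscissa [n - 1] the upper line meets the lower line of index [n - 2]. *)
Lemma polytope_fst_max p : P p -> p.1 = N - 1 -> p = split_point (n - 1).
Proof.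
move=> Pp p1; apply: plane_eq; first by rewrite p1 /= pred_n.
have := polytope_up Pp; have := polytope_low (n - 2) Pp.
have := split_point_lowS (n - 2); have := split_point_up_last.
have -> : ((n - 2).+1 = n - 1)%N by lia.
rewrite /line /= p1 pred_n => e1 e2 h1 h2.
by apply/eqP; rewrite eq_le [X in _ <= X]e1 h2 [X in X <= _]e2 h1.
Qed.

Lemma facets_cases F : facets P F ->
  (exists2 k, (1 <= k <= n - 2)%N & F = P `&` low_line k) \/ F = P `&` up_line.
Proof.
move=> [[c [d [cd eF]]] [k [rP rF]]].
have k2 : k = 2%N by have := affine_rank_uniq rP polytope_rank; lia.
rewrite {}k2 {k rP} in rF.
move: cd eF; have [a [b cE]] : exists a b, c =1 functional a b.
  by exists (c (1, 0)), (c (0, 1)) => p; apply: functionalE.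
move=> cd eF; have {}cd p : P p -> functional a b p <= d by rewrite -cE; apply: cd.
have {c cE}eF : F = P `&` [set r | functional a b r = d].
  by rewrite eF; congr (_ `&` _); apply/seteqP; split => r /=; rewrite cE.
(* Affine rank 2 provides two points; if they were equal, the weights 1 and -1 would be a
   dependency. *)
have [p [q [Fp Fq pq]]] : exists p q, [/\ F p, F q & p != q].
  have [[r [Fr ir]] _] := rF; exists (r 0), (r 1); split => //.
  apply/eqP => e; have := ir (fun i => if i == 0 then 1 else -1).
  rewrite !big_ord_recl !big_ord0 /= !addr0 subrr => /(_ erefl).
  have -> : lift ord0 ord0 = 1 :> 'I_2 by apply/val_inj.
  rewrite -[ord0]/(0 : 'I_2) e scale1r scaleN1r subrr => /(_ erefl 0).
  by move/eqP; rewrite /= oner_eq0.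
move: Fp Fq (Fp) (Fq); rewrite {1 2}eF => -[Pp cp] [Pq cq] Fp Fq.
have on_line s t : b != 0 -> line s t p -> line s t q -> F = P `&` line s t.
  by move=> b0 lp lq; rewrite eF (line_functional lp lq pq cp cq b0).
have [p1 pn] := polytope_range Pp; have [q1 qn] := polytope_range Pq.
have [b_lt|b_gt|b0] := ltgtP b 0; last first.
- exfalso; have cx r : functional a b r = a * r.1 by rewrite /functional b0 mul0r addr0.
  have first_max r : P r -> a * r.1 <= d by move/cd; rewrite cx.
  rewrite /= !cx in cp cq.
  have P1 : P (split_point 1) by apply: split_point_polytope; lia.
  have Pn : P (split_point (n - 1)) by apply: split_point_polytope; lia.
  have := first_max _ Pn; have := first_max _ P1; rewrite /= pred_n.
  have [a_lt|a_gt|a0] := ltgtP a 0.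
  + move=> h _; move/eqP: pq; apply.
    have ext r : P r -> a * r.1 = d -> r = split_point 1.
      move=> Pr er; apply: (polytope_fst_min Pr); have [r1 _] := polytope_range Pr.
      by apply/eqP; rewrite eq_le r1 andbT -(ler_nM2l a_lt) er.
    by rewrite (ext p) // (ext q).
  + move=> _ h; move/eqP: pq; apply.
    have ext r : P r -> a * r.1 = d -> r = split_point (n - 1).
      move=> Pr er; apply: (polytope_fst_max Pr); have [_ rn] := polytope_range Pr.
      by apply/eqP; rewrite eq_le rn /= -(ler_pM2l a_gt) er.
    by rewrite (ext p) // (ext q).
  (* A constant functional cuts out the whole polytope, whose rank is 3 instead of 2. *)
  + move=> _ _; have PF : P = F.
      rewrite eF; apply/seteqP; split=> [r Pr|r []//]; split=> //=.
      by rewrite cx -cp a0 !mul0r.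
    by have := affine_rank_uniq rF; rewrite -PF => /(_ _ polytope_rank).
- right; have on r : P r -> functional a b r = d -> up_line r.
    move=> Pr er; have [r1 rn] := polytope_range Pr.
    have := cd _ (up_point_polytope r1 rn); rewrite -er /functional /= lerD2l ler_pM2l //.
    by move=> h; apply/eqP; rewrite eq_le (polytope_up Pr).
  by apply: on_line; rewrite ?gt_eqF //; apply: on.
- left; have [m [Pm em1 em2]] : exists m : plane,
    [/\ P m, m.1 = (p.1 + q.1) / 2 & m.2 = (p.2 + q.2) / 2].
    exists (2^-1 *: p + (1 - 2^-1) *: q); split.
    + by apply: conv_hull_segment => //; lra.
    + by rewrite /= -![_ *: _]/(_ * _ : R); field.
    + by rewrite /= -![_ *: _]/(_ * _ : R); field.
  have cm : functional a b m = d.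
    have -> : functional a b m = (functional a b p + functional a b q) / 2.
      by rewrite /functional em1 em2; field.
    by rewrite cp cq; field.
  have [m1 mn] := polytope_range Pm.
  have [k kn /cd] := low_point_polytope m1 mn.
  rewrite -cm /functional /= lerD2l ler_nM2l // => h; exists k => //.
  (* [p] and [q] lie on or above the lower line and their midpoint on or below it, so both lie on
     it. *)
  have hp := polytope_low k Pp; have hq := polytope_low k Pq.
  rewrite em1 em2 in h.
  by apply: on_line; rewrite ?lt_eqF // /line /=; move: h hp hq; lra.
Qed.

Lemma facetsE : facets P =
  [set F | exists2 k, (1 <= k <= n - 2)%N & F = P `&` low_line k]
    `|` [set P `&` up_line].
Proof.
apply/seteqP; split=> F; first exact: facets_cases.
by case=> [[k kn ->]|->]; [exact: low_facet|exact: up_facet].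
Qed.

(** * Distinctness of the facets *)

Lemma line_slope_inj (s t s' t' : R) (p q : plane) : p.1 != q.1 ->
  line s t p -> line s t q -> line s' t' p -> line s' t' q -> s = s'.
Proof.
move: p q => [x y] [x' y']; rewrite /line /= => xx -> -> e e'.
have /eqP : (s - s') * (x - x') = 0 by move: e e'; lra.
by rewrite mulf_eq0 !subr_eq0 (negPf xx) orbF => /eqP.
Qed.

Lemma low_line_inj k k' : (1 <= k <= n - 2)%N ->
  P `&` low_line k = P `&` low_line k' -> k = k'.
Proof.
move=> kn e.
have [Pk Pk1] : P (split_point k) /\ P (split_point k.+1).
  by split; apply: split_point_polytope; lia.
have [_ l1] : (P `&` low_line k') (split_point k).
  by rewrite -e; split => //; apply: split_point_low.
have [_ l2] : (P `&` low_line k') (split_point k.+1).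
  by rewrite -e; split => //; apply: split_point_lowS.
have /addIr : low_slope k = low_slope k'.
  apply: line_slope_inj (split_point_low k) (split_point_lowS k) l1 l2.
  by rewrite /= eqr_nat; lia.
by rewrite -!natrX => /eqP; rewrite eqr_nat eqn_exp2l // => /eqP.
Qed.

Lemma low_line_neq_up_line k : (1 <= k <= n - 2)%N ->
  P `&` low_line k <> P `&` up_line.
Proof.
move=> kn e.
have [P1 Pn] : P (split_point 1) /\ P (split_point (n - 1)).
  by split; apply: split_point_polytope; lia.
have [_ l1] : (P `&` low_line k) (split_point 1).
  by rewrite e; split => //; apply: split_point_up1.
have [_ ln] : (P `&` low_line k) (split_point (n - 1)).
  by rewrite e; split => //; apply: split_point_up_last.
(* For [k >= 2] the lower line has ordinate at most [N - 1] at abscissa 1, below the point [N + 1]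
   of the complete graph. *)
have k1 : k = 1%N.
  apply/eqP; rewrite eqn_leq andbC; case/andP: kn => -> _ /=.
  rewrite leqNgt; apply/negP => k2; move: l1.
  rewrite /low_line /line /= /low_slope /low_const expr1.
  have : 0 <= 2 ^+ k * (k%:R - 2) :> R.
    by rewrite mulr_ge0 ?exprn_ge0 // subr_ge0 ler_nat.
  by move: (2 ^+ k) (k%:R) => x y; lra.
(* The line of index 1 through the last point would give [2^(n-1) = 2 (n - 1)], against
   [2^(n-1) >= 4 (n - 2)]. *)
have := pow_tangent 2 (n - 1); move: ln N8.
rewrite k1 /low_line /line /= /low_slope /low_const pred_n expr1.
by rewrite [2 ^+ 2]expr2; move: (2 ^+ _) N => x y; lra.
Qed.

End Polytope.

Theorem theorem5 (R : realType) (n : nat) (n_ge8 : (8 <= n)%N) :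
  let P := connected_polytope R n in
  let lower (k : nat) (x : R) : R :=
    (2 ^+ k - 1) * x + 2 ^+ k * (1 - k%:R) + n%:R in
  let upper (x : R) : R :=
    (2 ^+ (n - 1)%N - n%:R) / (n%:R - 2) * (x - 1) + n%:R + 1 in
  [/\ facets P #= `I_(n - 1),
      forall k : nat, (1 <= k <= n - 2)%N ->
        forall p, P p -> p.2 >= lower k p.1,
      forall p, P p -> p.2 <= upper p.1
    & facets P =
        [set F | exists2 k : nat, (1 <= k <= n - 2)%N &
                   F = P `&` [set p | p.2 = lower k p.1]]
        `|` [set P `&` [set p | p.2 = upper p.1]]].
Proof.
move=> P lower upper.
have lowE k x : lower k x = low_slope R k * x + low_const R n k.
  by rewrite /lower /low_const addrA.
have upE x : upper x = up_slope R n * x + up_const R n.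
  by rewrite /upper /up_const -/(up_slope R n); ring.
have low_lineE k : [set p : R^o * R^o | p.2 = lower k p.1] = low_line n k.
  by apply/seteqP; split=> p /=; rewrite /low_line /line /= lowE.
have up_lineE : [set p : R^o * R^o | p.2 = upper p.1] = up_line n.
  by apply/seteqP; split=> p /=; rewrite /up_line /line /= upE.
have facetsE' : facets P = [set F | exists2 k : nat, (1 <= k <= n - 2)%N &
                   F = P `&` [set p | p.2 = lower k p.1]]
        `|` [set P `&` [set p | p.2 = upper p.1]].
  rewrite /P (facetsE R n_ge8) up_lineE; congr (_ `|` _).
  by apply/seteqP; split=> F [k kn ->]; exists k; rewrite ?low_lineE.
split => //.
(* The indices below [n - 2] enumerate the lower facets, shifted by one; the index [n - 2] is the
   upper facet. *)
- pose f i := if (i < n - 2)%N then P `&` low_line n i.+1 else P `&` up_line n.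
  have -> : facets P = f @` `I_(n - 1).
    rewrite /P (facetsE R n_ge8); apply/seteqP; split=> F /=.
      case=> [[k kn ->]|->].
        exists k.-1; first by rewrite /=; lia.
        by rewrite /f prednK ?ifT //; lia.
      by exists (n - 2)%N; rewrite /= ?/f ?ltnn //; lia.
    case=> i /= ilt <-; rewrite /f; case: ifP => h; [left|by right].
    by exists i.+1 => //; lia.
  apply: inj_card_eq => i j; rewrite !inE /= /f => ilt jlt.
  case: ifP => hi; case: ifP => hj.
  + by move=> e; apply/eq_add_S/(low_line_inj n_ge8 _ e); lia.
  + by move=> e; case: (low_line_neq_up_line n_ge8 _ e); lia.
  + by move=> e; case: (low_line_neq_up_line n_ge8 _ (esym e)); lia.
  + by lia.
- by move=> k kn p Pp; rewrite lowE; apply: polytope_low.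
- by move=> p Pp; rewrite upE; apply: polytope_up.
Qed.
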